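(* Let $r_1,\ldots,r_s$ be positive integers and let $G$ be a graph of order $n\ge 2\alpha'+2$, matching number $\alpha'$ and minimum degree $\delta(G)\ge k$. Then $$N(K_{r_1,\ldots,r_s},G)\le \max\{g_{r_1,\ldots,r_s}(n,2\alpha',k),\ g_{r_1,\ldots,r_s}(n,2\alpha',\alpha')\}.$$
   Context: The matching number of a graph is the maximum size of a set of pairwise disjoint edges. For positive integers $r_1,\ldots,r_s$, $K_{r_1,\ldots,r_s}$ denotes the complete multipartite graph with $s$ parts of sizes $r_1,\ldots,r_s$. For graphs $H$ and $G$, $N(H,G)$ denotes the number of subgraphs of $G$ isomorphic to $H$. For integers $n,c,k$ with $k\ge 0$ and $n-1\ge c\ge 2k$, let $G(n,c,k)=K_k\vee\left(K_{c+1-2k}+\overline{K_{n-c-1+k}}\right)$, where $\vee$ denotes join (disjoint union plus all edges between the two graphs), $+$ denotes disjoint union, $K_m$ is the complete graph on $m$ vertices ($K_0$ empty), and $\overline{K_m}$ is the edgeless graph on $m$ vertices. Define $g_{r_1,\ldots,r_s}(n,c,k)=N(K_{r_1,\ldots,r_s},G(n,c,k))$. *)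

(* Defs.v *)
From mathcomp Require Import all_boot.

Set Implicit Arguments.
Unset Strict Implicit.
Unset Printing Implicit Defensive.

Record sgraph := SGraph {
  vertex :> finType;
  adj : rel vertex;
  adj_sym : symmetric adj;
  adj_irrefl : irreflexive adj
}.

Definition edges (G : sgraph) : {set {set G}} :=
  [set e | [exists x : G, exists y : G, adj x y && (e == [set x; y])]].

Definition matching (G : sgraph) (M : {set {set G}}) : bool :=
  (M \subset edges G) && trivIset M.

Definition matching_number (G : sgraph) : nat :=
  \max_(M : {set {set G}} | matching M) #|M|.

Definition degree (G : sgraph) (x : G) : nat := #|[set y | adj x y]|.

(* Every degree is smaller than #|G|, so the default value #|G| of the minimum
   is only attained by the graph without vertices. *)
Definition min_degree (G : sgraph) : nat :=
  \big[minn/#|G|]_(x : G) degree x.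

Definition isomorphic (H K : sgraph) : bool :=
  [exists f : {ffun H -> K},
    [&& injectiveb f, [forall y : K, y \in codom f] &
        [forall x : H, forall y : H, adj (f x) (f y) == adj x y]]].

Definition is_subgraph (G : sgraph) (W : {set G}) (F : {set {set G}}) : bool :=
  (F \subset edges G) && [forall e in F, e \subset W].

Section Subgraph.
Variables (G : sgraph) (W : {set G}) (F : {set {set G}}).

(* The conjunct x != y is redundant when F consists of edges of G; it makes the
   relation irreflexive for every F. *)
Definition sub_adj : rel {x : G | x \in W} :=
  fun x y => (x != y) && ([set val x; val y] \in F).

Lemma sub_adj_sym : symmetric sub_adj.
Proof. by move=> x y; rewrite /sub_adj eq_sym setUC. Qed.

Lemma sub_adj_irrefl : irreflexive sub_adj.
Proof. by move=> x; rewrite /sub_adj eqxx. Qed.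

Definition subgraph : sgraph := SGraph sub_adj_sym sub_adj_irrefl.

End Subgraph.

(* Subgraphs are pairs (vertex set, edge set) and are not assumed induced. *)
Definition nb_copies (H G : sgraph) : nat :=
  #|[set p : {set G} * {set {set G}} |
      is_subgraph p.1 p.2 && isomorphic H (subgraph p.1 p.2)]|.

Section Constructions.

Definition complete_adj m : rel 'I_m := fun x y => x != y.

Lemma complete_adj_sym m : symmetric (@complete_adj m).
Proof. by move=> x y; rewrite /complete_adj eq_sym. Qed.

Lemma complete_adj_irrefl m : irreflexive (@complete_adj m).
Proof. by move=> x; rewrite /complete_adj eqxx. Qed.

Definition complete_graph m : sgraph :=
  SGraph (@complete_adj_sym m) (@complete_adj_irrefl m).

Definition edgeless_adj m : rel 'I_m := fun _ _ => false.

Lemma edgeless_adj_sym m : symmetric (@edgeless_adj m).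
Proof. by []. Qed.

Lemma edgeless_adj_irrefl m : irreflexive (@edgeless_adj m).
Proof. by []. Qed.

Definition edgeless_graph m : sgraph :=
  SGraph (@edgeless_adj_sym m) (@edgeless_adj_irrefl m).

Variables G H : sgraph.

Definition union_adj : rel (G + H)%type := fun u v =>
  match u, v with
  | inl x, inl y => adj x y
  | inr x, inr y => adj x y
  | _, _ => false
  end.

Lemma union_adj_sym : symmetric union_adj.
Proof. by move=> [x|x] [y|y] //=; rewrite adj_sym. Qed.

Lemma union_adj_irrefl : irreflexive union_adj.
Proof. by move=> [x|x] /=; rewrite adj_irrefl. Qed.

Definition disjoint_union : sgraph := SGraph union_adj_sym union_adj_irrefl.

Definition join_adj : rel (G + H)%type := fun u v =>
  match u, v with
  | inl x, inl y => adj x y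
  | inr x, inr y => adj x y
  | _, _ => true
  end.

Lemma join_adj_sym : symmetric join_adj.
Proof. by move=> [x|x] [y|y] //=; rewrite adj_sym. Qed.

Lemma join_adj_irrefl : irreflexive join_adj.
Proof. by move=> [x|x] /=; rewrite adj_irrefl. Qed.

Definition graph_join : sgraph := SGraph join_adj_sym join_adj_irrefl.

End Constructions.

Section Multipartite.
Variables (s : nat) (r : 'I_s -> nat).

Definition multipartite_adj : rel {i : 'I_s & 'I_(r i)} :=
  fun u v => tag u != tag v.

Lemma multipartite_adj_sym : symmetric multipartite_adj.
Proof. by move=> u v; rewrite /multipartite_adj eq_sym. Qed.

Lemma multipartite_adj_irrefl : irreflexive multipartite_adj.
Proof. by move=> u; rewrite /multipartite_adj eqxx. Qed.

Definition complete_multipartite : sgraph :=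
  SGraph multipartite_adj_sym multipartite_adj_irrefl.

End Multipartite.

(* The graph G(n, c, k), meaningful for 2k <= c <= n - 1; in that range the
   natural number subtractions below are not truncated. *)
Definition extremal_graph (n c k : nat) : sgraph :=
  graph_join (complete_graph k)
    (disjoint_union (complete_graph (c + 1 - 2 * k))
                    (edgeless_graph (n - c - 1 + k))).

Definition g_multipartite (s : nat) (r : 'I_s -> nat) (n c k : nat) : nat :=
  nb_copies (complete_multipartite r) (extremal_graph n c k).

(* Main.v *)
(** Write [f t] for the number of embeddings of a complete multipartite graph [H]
    into [G(n, 2a, t)]. Adding an edge between non-adjacent vertices whose degrees
    sum to more than [2a] cannot raise the matching number above [a], so one may
    assume that no such pair exists. Let then [u, v] be a non-adjacent pair of
    largest degree sum, with [t = deg u <= deg v]; the [n - 1 - deg v >= n - 1 - 2a + t]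
    vertices not adjacent to [v] all have degree at most [t]. Deleting that many of
    them one at a time loses at most as many embeddings as deleting the edgeless
    part of [G(n, 2a, t)], since an embedding through a deleted vertex in part [i]
    sends all the other parts into its neighbourhood. Hence [G] has at most [f t]
    embeddings with [k <= t <= a], and [f] is convex on [[0, a]]. Finally the
    number of embeddings is the number of copies times the number of automorphisms
    of [H]. *)
Require Import Defs.
From mathcomp Require Import all_boot zify.

Set Implicit Arguments.
Unset Strict Implicit.
Unset Printing Implicit Defensive.

(** * A convex bound *)

Lemma leq_ffact2l (m n k : nat) : m <= n -> m ^_ k <= n ^_ k.
Proof.
move=> le_mn; rewrite !ffact_prod; apply: leq_prod => i _; exact: leq_sub2r.
Qed.

(** An injection into [n.+1] points either misses the last point or takes it at exactly one of its
    [k] arguments. *)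
Lemma ffactSn (n k : nat) : n.+1 ^_ k = n ^_ k + k * n ^_ k.-1.
Proof.
case: k => [|k]; first by rewrite !ffactn0 mul0n.
rewrite ffactSS ffactnSr /=.
have [lt_nk|le_kn] := ltnP n k; last by rewrite [_ * (n - k)]mulnC -mulnDl addnS subnK.
by rewrite (ffact_small lt_nk) mul0n !muln0.
Qed.

Lemma ffactD (n j k : nat) : n ^_ (j + k) = n ^_ j * (n - j) ^_ k.
Proof.
elim: j n => [|j IHj] n; first by rewrite ffactn0 mul1n subn0.
by rewrite addSn !ffactnS IHj mulnA -subn1 -subnDA add1n.
Qed.

(** The increments [P t - Q t] of [f] are non-decreasing; the additive form avoids truncated
    subtraction. A non-negative increment at [t] persists and makes [f] climb up to [a]; a negative
    one holds at all smaller arguments too, so [f] falls from [k] to [t]. *)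
Lemma max_convex (f P Q : nat -> nat) (a : nat) :
  (forall t, t < a -> f t.+1 + Q t = f t + P t) ->
  (forall t, t.+1 < a -> P t <= P t.+1) ->
  (forall t, t.+1 < a -> Q t.+1 <= Q t) ->
  forall k t, k <= t <= a -> f t <= maxn (f k) (f a).
Proof.
move=> fE P_incr Q_decr k t /andP[le_kt le_ta]; rewrite leq_max.
have [eq_ta|lt_ta] := leqP a t.
  by (have -> : t = a by lia); rewrite leqnn orbT.
have [le_QP|lt_PQ] := leqP (Q t) (P t).
  apply/orP; right.
  have mono d : t + d <= a ->
      f t <= f (t + d) /\ (t + d < a -> Q (t + d) <= P (t + d)).
    elim: d => [|d IHd] le_tda; first by rewrite addn0.
    have /IHd[le_f le_QPd] : t + d <= a by lia.
    have lt_tda : t + d < a by lia.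
    rewrite addnS; split; first by have := fE _ lt_tda; have := le_QPd lt_tda; lia.
    move=> lt_Sa; have := P_incr _ lt_Sa; have := Q_decr _ lt_Sa.
    by have := le_QPd lt_tda; lia.
  have /mono[le_f _] : t + (a - t) <= a by lia.
  by rewrite subnKC in le_f.
apply/orP; left.
have mono d : d <= t ->
    f t <= f (t - d) /\ (t - d < a -> P (t - d) < Q (t - d)).
  elim: d => [|d IHd] le_dt; first by rewrite subn0.
  have /IHd[le_f lt_PQd] : d <= t by lia.
  have eS : t - d = (t - d.+1).+1 by lia.
  rewrite eS in le_f lt_PQd.
  have lt_a : (t - d.+1).+1 < a by lia.
  have Pi := P_incr _ lt_a; have Qd := Q_decr _ lt_a; have lPQ := lt_PQd lt_a.
  have := fE _ (ltnW lt_a); split; lia.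
have /mono[le_f _] : t - k <= t by lia.
by rewrite subKn in le_f.
Qed.

Section EmbeddingBound.
Variables (V : finType) (q p : V -> nat).
Hypothesis qp : forall h, (q h + p h).+1 = #|V|.

(* For V the vertices of K_{r_1,...,r_s}, q h and p h count the vertices other than
   h outside and inside the part of h. This bounds the embeddings through a vertex
   of degree t in a graph with m other vertices. *)
Definition emb_weight (t m : nat) : nat :=
  \sum_(h : V) t ^_ (q h) * (m - q h) ^_ (p h).

(** The first term counts injections into the clique on [c.+1 - t] vertices of [G(n, c, t)]; the sum
    then adds the independent vertices, each of degree [t], one at a time, with [m] vertices already
    present. *)
Definition emb_bound (n c t : nat) : nat :=
  (c.+1 - t) ^_ #|V| + \sum_(c.+1 - t <= m < n) emb_weight t m.

Lemma emb_bound_convex (n a k t : nat) :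
  2 * a < n -> k <= t <= a ->
  emb_bound n (2 * a) t <= maxn (emb_bound n (2 * a) k) (emb_bound n (2 * a) a).
Proof.
move=> lt_an.
(* P and Q split the increment of emb_bound into an increasing gain and a
   decreasing loss. *)
pose P t := \sum_((2 * a).+1 - t <= m < n)
  \sum_(h : V) (q h * t ^_ (q h).-1) * (m - q h) ^_ (p h).
pose Q t := \sum_(h : V)
  ((2 * a - t) ^_ (q h) - t.+1 ^_ (q h)) * (2 * a - t - q h) ^_ (p h).
apply: (@max_convex _ P Q) => [{}t lt_ta|{}t lt_ta|{}t lt_ta].
- have eS : (2 * a).+1 - t = (2 * a - t).+1 by lia.
  rewrite /emb_bound /P subSS eS ffactSn.
  rewrite [in LHS]big_ltn; last by lia.
  set x := 2 * a - t.
  have lt_tx : t.+1 <= x by rewrite /x; lia.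
  (* One vertex leaves the clique: it was adjacent to all [x] remaining clique vertices and keeps
     only [t.+1] of these neighbours, at a cost of [Q t]. *)
  have -> : #|V| * x ^_ #|V|.-1 = emb_weight t.+1 x + Q t.
    rewrite /emb_weight /Q -big_split -sum_nat_const; apply: eq_bigr => h _ /=.
    rewrite -/x -mulnDl subnKC ?leq_ffact2l // -ffactD.
    by rewrite -(qp h).
  (* Each vertex already outside the clique gains one neighbour; the total gain is [P t]. *)
  have -> : \sum_(x.+1 <= m < n) emb_weight t.+1 m
    = \sum_(x.+1 <= m < n) emb_weight t m + \sum_(x.+1 <= m < n)
         \sum_h q h * t ^_ (q h).-1 * (m - q h) ^_ p h.
    rewrite -big_split; apply: eq_bigr => m _; rewrite -big_split.
    by apply: eq_bigr => h _; rewrite ffactSn mulnDl.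
  lia.
- have eS : (2 * a).+1 - t = (2 * a - t).+1 by lia.
  rewrite /P subSS eS [leqRHS]big_ltn; last by lia.
  apply: leq_trans (leq_addl _ _); apply: leq_sum => m _; apply: leq_sum => h _.
  by rewrite leq_mul2r leq_mul2l leq_ffact2l ?orbT.
- apply: leq_sum => h _; apply: leq_mul; last by apply: leq_ffact2l; lia.
  by apply: leq_sub; apply: leq_ffact2l; lia.
Qed.

End EmbeddingBound.

(** * Injections with prescribed ranges *)

Section PartialInjections.
Variables (V T : finType) (d : T).
Implicit Types (B : V -> {set T}) (S Q : {set V}).

(** Partial injections with domain [S], made total by the default value [d] so that each is counted
    once. They can then be counted by enlarging the domain step by step. *)
Definition pinj B S : {set {ffun V -> T}} :=
  [set f : {ffun V -> T} | [forall x, if x \in S then f x \in B x else f x == d]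
      && [forall x in S, forall y in S, (f x == f y) ==> (x == y)]].

Lemma pinjP B S (f : {ffun V -> T}) :
  reflect [/\ {in S, forall x, f x \in B x}, forall x, x \notin S -> f x = d
            & {in S &, injective f}] (f \in pinj B S).
Proof.
rewrite inE; apply: (iffP andP) => [[/forallP fB /forall_inP fI]|[fB fd fI]].
  split=> [x xS|x xS|x y xS yS eq_f].
  - by have := fB x; rewrite xS.
  - by have := fB x; rewrite (negPf xS) => /eqP.
  - by have /forall_inP/(_ y yS)/implyP := fI x xS; rewrite eq_f eqxx => /(_ isT)/eqP.
split; first by apply/forallP => x; case: ifPn => [/fB|/fd->].
apply/forall_inP => x xS; apply/forall_inP => y yS; apply/implyP => /eqP.
by move/(fI _ _ xS yS)->.
Qed.

Lemma pinjT B (f : {ffun V -> T}) :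
  reflect ((forall x, f x \in B x) /\ injective f) (f \in pinj B setT).
Proof.
apply: (iffP (pinjP _ _ _)) => [[fB _ fI]|[fB fI]].
  by split=> [x|x y]; [apply: fB; rewrite inE | apply: fI; rewrite inE].
by split=> [x _||x y _ _ /fI]; rewrite // => x; rewrite inE.
Qed.

Lemma card_pinj0 B : #|pinj B set0| = 1.
Proof.
apply/eqP/cards1P; exists [ffun=> d]; apply/setP => f; rewrite inE.
apply/pinjP/eqP => [[_ fd _]|->].
  by apply/ffunP => x; rewrite ffunE fd ?inE.
by split=> [x|x _|x y]; rewrite ?inE ?ffunE.
Qed.

(** The values taken on [S] all lie in [B x], so they use up exactly [#|S|] of its elements. The map
    [ext] is a bijection from pairs of an injection on [S] and a fresh value in [B x]. *)
Lemma card_pinjU1 B S x : x \notin S -> {in S, forall y, B y \subset B x} ->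
  #|pinj B (x |: S)| = #|pinj B S| * (#|B x| - #|S|).
Proof.
move=> xS sB.
pose ext (p : {ffun V -> T} * T) := [ffun y => if y == x then p.2 else p.1 y].
pose D := [set p : {ffun V -> T} * T | (p.1 \in pinj B S) && (p.2 \in B x :\: p.1 @: S)].
have extE p y : y \in S -> ext p y = p.1 y.
  by move=> yS; rewrite ffunE; case: eqVneq yS xS => // -> ->.
have -> : pinj B (x |: S) = ext @: D.
  apply/setP => f; apply/idP/imsetP => [/pinjP[fB fd fI]|[[g y]]].
    exists ([ffun y => if y == x then d else f y], f x).
      have resE y : y \in S -> [ffun y => if y == x then d else f y] y = f y.
        by move=> yS; rewrite ffunE; case: eqVneq yS xS => // -> ->.
      rewrite inE /= in_setD fB ?setU11 // andbT; apply/andP; split.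
        apply/pinjP; split=> [y yS|y yS|y z yS zS].
        - by rewrite resE // fB // inE yS orbT.
        - rewrite ffunE; case: eqVneq => // neq_yx.
          by apply: fd; rewrite !inE negb_or neq_yx.
        - by rewrite !resE //; apply: fI; rewrite inE ?yS ?zS orbT.
      apply/imsetP => -[y yS]; rewrite resE // => /fI eq_xy.
      by rewrite eq_xy ?yS ?setU11 ?inE ?yS ?orbT // in xS.
    by apply/ffunP => y; rewrite !ffunE; case: eqVneq => [->|] /=.
  rewrite inE /= in_setD => /and3P[/pinjP[gB gd gI] ygS yB] ->.
  apply/pinjP; split=> [z|z|z w]; rewrite !inE.
  - by rewrite ffunE; case: eqVneq => [->|_] //=; apply: gB.
  - by rewrite negb_or ffunE => /andP[/negPf->]; apply: gd.
  - rewrite !ffunE /=; case: eqVneq => [->|_] /=; case: eqVneq => [->|_] //=.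
    + by move=> _ wS yg; rewrite yg imset_f in ygS.
    + by move=> zS _ yg; rewrite -yg imset_f in ygS.
    + exact: gI.
rewrite card_in_imset => [|[g y] [h z]]; last first.
  rewrite ![_ \in D]inE /= !in_setD.
  move=> /and3P[/pinjP[gB gd gI] ygS yB] /and3P[/pinjP[hB hd hI] zhS zB].
  move=> /ffunP eq_ext; congr pair; last by have := eq_ext x; rewrite !ffunE eqxx.
  apply/ffunP => w; have := eq_ext w; rewrite !ffunE /=.
  by case: eqVneq => // -> _; rewrite gd ?hd.
rewrite -sum1dep_card.
rewrite -(pair_big_dep (mem (pinj B S)) (fun g y => y \in B x :\: g @: S)
           (fun _ _ => 1)) /=.
rewrite -sum_nat_const; apply: eq_bigr => g /pinjP[gB _ gI].
rewrite sum1_card cardsD -(card_in_imset gI); congr (_ - _).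
apply: eq_card => y; rewrite !inE andb_idl // => /imsetP[z zS ->].
exact: (subsetP (sB _ zS)) (gB _ zS).
Qed.

Lemma card_pinjU B (A : {set T}) S Q : [disjoint S & Q] ->
  {in S, forall y, B y \subset A} -> {in Q, forall y, B y = A} ->
  #|pinj B (S :|: Q)| = #|pinj B S| * (#|A| - #|S|) ^_ #|Q|.
Proof.
move=> dSQ sB eB; have [m le_Qm] := ubnP #|Q|.
elim: m => // m IHm in Q dSQ eB le_Qm *.
have [->|[x xQ]] := set_0Vmem Q; first by rewrite setU0 cards0 ffactn0 muln1.
have cQ := cardsD1 x Q; rewrite xQ add1n in cQ.
have sQ : Q :\ x \subset Q by rewrite subD1set.
have xS : x \notin S.
  by apply: contraTN xQ => xS; rewrite (disjointFr dSQ xS).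
have dSQx : [disjoint S & Q :\ x] by rewrite (disjointWr sQ).
rewrite -(setD1K xQ) setUCA card_pinjU1; last first.
- move=> y; rewrite [B x]eB // !inE => /orP[/sB//|/andP[_ yQ]]; by rewrite eB.
- by rewrite !inE eqxx (negPf xS).
rewrite IHm //; last 2 first.
- by move=> y /setD1P[_ /eB].
- by rewrite -ltnS -cQ.
rewrite setD1K // cQ ffactnSr -mulnA [B x]eB //; congr (_ * (_ * _)).
by rewrite cardsU [#|S :&: _|](_ : _ = 0) ?subn0 ?subnDA //; apply/eqP; rewrite cards_eq0 setI_eq0.
Qed.

Lemma card_inj_into (A : {set T}) : #|pinj (fun=> A) setT| = #|A| ^_ #|V|.
Proof.
have := @card_pinjU (fun=> A) A set0 setT.
rewrite set0U card_pinj0 cards0 subn0 mul1n cardsT; apply=> //.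
by rewrite disjoints_subset sub0set.
Qed.

(** With [P] the neighbours of [h], this is the summand of [emb_weight] at [h]: [h] goes to [v],
    then [P] is placed in [D], then everything else in what is left of [A]. *)
Lemma card_pinned_inj (v : T) (D A : {set T}) (h : V) (P : {set V}) :
  h \notin P -> v \notin D -> D \subset A -> v \notin A ->
  #|pinj (fun x => if x == h then [set v] else
                   if x \in P then v |: D else v |: A) setT|
   = #|D| ^_ #|P| * (#|A| - #|P|) ^_ (#|V| - #|P|).-1.
Proof.
move=> hP vD sDA vA.
pose B x := if x == h then [set v] else if x \in P then v |: D else v |: A.
rewrite -/B.
(* Including v in the larger ranges makes them nested, so that their elements can
   be chosen successively; injectivity excludes v from them anyway. *)
have hB : B h = [set v] by rewrite /B eqxx.
have PB x : x \in P -> B x = v |: D.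
  by move=> xP; rewrite /B xP; case: eqVneq xP hP => // -> ->.
have dhP : [disjoint [set h] & P] by rewrite disjoints1.
have c1 : #|pinj B [set h]| = 1.
  rewrite -[[set h]]setU0 card_pinjU1 ?inE // => [|y]; last by rewrite inE.
  by rewrite card_pinj0 hB cards1 cards0.
have c2 : #|pinj B (h |: P)| = #|D| ^_ #|P|.
  rewrite (@card_pinjU _ (v |: D)) // => [|y /set1P->]; last first.
    by rewrite hB sub1set setU11.
  by rewrite c1 mul1n cardsU1 vD cards1 add1n subn1.
rewrite -(setUCr (h |: P)) (@card_pinjU _ (v |: A)).
- rewrite c2 !cardsU1 hP vA.
  have := cardsC (h |: P); rewrite cardsU1 hP => <-.
  congr (_ * _ ^_ _); lia.
- by rewrite disjoints_subset setCK.
- move=> y; rewrite !inE /B; case: eqVneq => [_ _|_ /= yP].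
    by rewrite sub1set setU11.
  by rewrite yP setUS.
- by move=> y; rewrite !inE negb_or /B => /andP[/negPf-> /negPf->].
Qed.

End PartialInjections.

(** * Matchings and the closure *)

Section Matchings.
Variable G : sgraph.
Implicit Types (x y u v : G) (M : {set {set G}}).

Lemma edgesP (e : {set G}) :
  reflect (exists x y, adj x y /\ e = [set x; y]) (e \in edges G).
Proof.
rewrite inE; apply: (iffP existsP) => [[x /existsP[y /andP[xy /eqP->]]]|].
  by exists x, y.
by move=> [x [y [xy ->]]]; exists x; apply/existsP; exists y; rewrite xy eqxx.
Qed.

Lemma set2_in_edges x y : ([set x; y] \in edges G) = adj x y.
Proof.
apply/edgesP/idP => [[x' [y' [xy eq_xy]]]|xy]; last by exists x, y.
have neq_xy : x' != y' by apply: contraTneq xy => ->; rewrite adj_irrefl.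
have : x' \in [set x; y] by rewrite eq_xy set21.
have : y' \in [set x; y] by rewrite eq_xy set22.
have sym_xy : adj y' x' by rewrite adj_sym.
by move=> /set2P[]ey /set2P[]ex; move: xy sym_xy neq_xy; rewrite ex ey ?eqxx.
Qed.

Lemma leq_matching_number M : matching M -> #|M| <= matching_number G.
Proof. by move=> mM; rewrite /matching_number; apply: leq_bigmax_cond. Qed.

Lemma maximum_matching : exists2 M : {set {set G}}, matching M & #|M| = matching_number G.
Proof.
have m0 : matching (set0 : {set {set G}}).
  by rewrite /matching sub0set; apply/trivIsetP => A B; rewrite inE.
rewrite /matching_number (bigmax_eq_arg _ m0).
by case: arg_maxnP => // M mM _; exists M.
Qed.

Lemma set0_notin_matching M : matching M -> set0 \notin M.
Proof.
move=> /andP[/subsetP sME _]; apply/negP => /sME/edgesP[x [y [_ /setP/(_ x)]]].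
by rewrite !inE eqxx.
Qed.

Lemma matchingU1 M x y : matching M -> adj x y ->
  x \notin cover M -> y \notin cover M ->
  matching ([set x; y] |: M) /\ #|[set x; y] |: M| = #|M|.+1.
Proof.
move=> mM xy xM yM; have /andP[sME tM] := mM.
have disM B : B \in M -> [disjoint [set x; y] & B].
  move=> BM; rewrite disjoints_subset; apply/subsetP => z zxy; rewrite inE.
  apply: contraNN (_ : z \notin cover M) => [zB|].
    by apply/bigcupP; exists B.
  by case/set2P: zxy => ->.
have [tM' notM] := trivIsetU1 disM tM (set0_notin_matching mM).
by rewrite /matching subUset sub1set set2_in_edges xy sME tM' cardsU1 notM.
Qed.

Lemma matchingD1 M (e : {set G}) : matching M -> matching (M :\ e).
Proof.
move=> /andP[sME tM]; rewrite /matching trivIsetD // andbT.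
by apply: subset_trans sME; apply: subD1set.
Qed.

Lemma card_cover_matching M : matching M -> #|cover M| = 2 * #|M|.
Proof.
move=> /andP[/subsetP sME /eqP <-].
rewrite mulnC -sum_nat_const; apply: eq_bigr => e /sME/edgesP[x [y [xy ->]]].
by rewrite cards2; case: eqVneq xy => [->|//]; rewrite adj_irrefl.
Qed.

End Matchings.

Section AddEdge.
Variables (G : sgraph) (u v : G).

Definition add_edge_adj : rel G := fun x y =>
  adj x y || (u != v) && ([set x; y] == [set u; v]) && (x != y).

Lemma add_edge_sym : symmetric add_edge_adj.
Proof. by move=> x y; rewrite /add_edge_adj adj_sym setUC [x == y]eq_sym. Qed.

Lemma add_edge_irrefl : irreflexive add_edge_adj.
Proof. by move=> x; rewrite /add_edge_adj adj_irrefl eqxx andbF. Qed.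

Definition add_edge : sgraph := SGraph add_edge_sym add_edge_irrefl.

Lemma matching_add_edge (M : {set {set G}}) :
  @matching add_edge M -> [set u; v] \notin M -> @matching G M.
Proof.
rewrite /matching => /andP[/subsetP sME ->] uvM; rewrite andbT.
apply/subsetP => e eM; have /edgesP[x [y [xy e_xy]]] := sME _ eM.
rewrite e_xy set2_in_edges; case/orP: xy => // /andP[/andP[_ /eqP xy] _].
by rewrite -xy -e_xy eM in uvM.
Qed.

(** A matching of size above [a] in the larger graph must use the new edge. Without that edge it is
    a matching [M'] of [G] of size [a], hence maximum, that misses [u] and [v], and the absence of
    augmenting paths bounds the degree sum. *)
Lemma matching_number_closure (a : nat) :
  u != v -> ~~ adj u v -> 2 * a < degree u + degree v ->
  matching_number G <= a -> matching_number add_edge <= a.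
Proof.
move=> neq_uv uv deg_uv mnG.
have [M mM <-] : exists2 M : {set {set G}}, @matching add_edge M
    & #|M| = matching_number add_edge := maximum_matching add_edge.
rewrite leqNgt; apply/negP => lt_aM.
have small (N : {set {set G}}) : @matching G N -> #|N| <= a.
  by move=> mN; apply: leq_trans (leq_matching_number mN) mnG.
have uvM : [set u; v] \in M.
  by apply: contraLR lt_aM => uvM; rewrite -leqNgt small // matching_add_edge.
pose M' := M :\ [set u; v].
have mM' : @matching G M'.
  by apply: matching_add_edge; [exact: matchingD1 | rewrite !inE eqxx].
have cM : #|M| = #|M'|.+1 by rewrite (cardsD1 [set u; v]) uvM.
have cM' : #|M'| = a by have := small _ mM'; lia.
have /andP[sM'E tM'] := mM'.
have covM' : cover M' = cover M :\: [set u; v].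
  by apply: coverD1 uvM; case/andP: mM.
have uM' : u \notin cover M' by rewrite covM' !inE eqxx.
have vM' : v \notin cover M' by rewrite covM' !inE eqxx orbT.
have nbr x y : x \notin cover M' -> adj x y -> y \in cover M'.
  move=> xM' xy; apply: contraT => yM'.
  have [mN cN] := matchingU1 mM' xy xM' yM'.
  by have := small _ mN; rewrite cN cM' ltnn.
(* Otherwise u - x - y - v would be an augmenting path. *)
have no_aug x y : [set x; y] \in M' -> x != y -> adj u x -> adj v y -> False.
  move=> xyM' neq_xy ux vy.
  have mM'' := matchingD1 [set x; y] mM'.
  have covM'' : cover (M' :\ [set x; y]) = cover M' :\: [set x; y].
    exact: coverD1.
  have [xM' yM'] := (nbr _ _ uM' ux, nbr _ _ vM' vy).
  have [mN cN] : matching ([set u; x] |: M' :\ [set x; y]) /\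
      #|[set u; x] |: M' :\ [set x; y]| = #|M' :\ [set x; y]|.+1.
    by apply: matchingU1; rewrite // covM'' !inE ?eqxx ?(negPf uM') ?andbF.
  have covN : cover ([set u; x] |: M' :\ [set x; y])
      = [set u; x] :|: (cover M' :\: [set x; y]).
    by rewrite -covM'' /cover bigcup_setU big_set1.
  have [||mN' cN'] := matchingU1 mN vy.
  - rewrite covN !inE (negPf vM') andbF orbF negb_or eq_sym neq_uv.
    by apply: contraNneq vM' => ->.
  - rewrite covN !inE eqxx orbT orbF /= negb_or [y == x]eq_sym neq_xy andbT.
    by apply: contraNneq uM' => <-.
  have := cardsD1 [set x; y] M'; rewrite xyM' cM' => eq_a.
  by have := small _ mN'; rewrite cN' cN eq_a add1n ltnn.
have degE x : x \notin cover M' ->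
    degree x = \sum_(e in M') \sum_(w in e | adj x w) 1.
  move=> xM'; rewrite -big_trivIset_cond // /degree -sum1dep_card.
  apply: eq_bigl => w; case: (boolP (adj x w)) => xw; last by rewrite andbF.
  by rewrite (nbr _ _ xM' xw).
(* All neighbours of [u] and [v] are covered by [M'], so the degrees can be summed edge by edge, and
   each edge should contribute at most 2. *)
suff : degree u + degree v <= 2 * a by lia.
rewrite !degE // -big_split -cM' mulnC -sum_nat_const.
apply: leq_sum => e eM' /=.
have /edgesP[x [y [xy e_xy]]] := subsetP sM'E _ eM'; rewrite {e}e_xy in eM' *.
have neq_xy : x != y by apply: contraTneq xy => ->; rewrite adj_irrefl.
have big2 (p : pred G) : \sum_(w in [set x; y] | p w) 1 = p x + p y.
  rewrite big_mkcondr big_setU1 ?inE // big_set1.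
  by case: (p x); case: (p y).
(* Applied to both orientations of the edge, [no_aug] excludes [u ~ x, v ~ y] and [u ~ y, v ~ x], so
   at most two of the four adjacencies hold. *)
rewrite !big2; have := no_aug _ _ eM' neq_xy.
rewrite setUC eq_sym in eM' neq_xy; have := no_aug _ _ eM' neq_xy.
case: (adj u x); case: (adj u y); case: (adj v x); case: (adj v y) => //=.
all: try by move=> /(_ isT isT).
all: by move=> _ /(_ isT isT).
Qed.

End AddEdge.

(** * Copies and embeddings *)

Section Copies.
Variables H G : sgraph.
Implicit Types (f : {ffun H -> G}).

Definition embeddings : {set {ffun H -> G}} :=
  [set f : {ffun H -> G} | injectiveb f &
    [forall x : H, forall y : H, adj x y ==> adj (f x) (f y)]].

Lemma embeddingsP f :
  reflect (injective f /\ forall x y, adj x y -> adj (f x) (f y)) (f \in embeddings).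
Proof.
rewrite inE; apply: (iffP andP) => [[/injectiveP fI /forallP fA]|[fI fA]].
  by split=> // x y; apply/implyP; have /forallP := fA x.
split; first exact/injectiveP.
by apply/forallP => x; apply/forallP => y; apply/implyP; apply: fA.
Qed.

Definition automorphisms : {set {ffun H -> H}} :=
  [set f : {ffun H -> H} | injectiveb f &
    [forall x : H, forall y : H, adj (f x) (f y) == adj x y]].

Lemma automorphismsP (f : {ffun H -> H}) :
  reflect (injective f /\ forall x y, adj (f x) (f y) = adj x y)
    (f \in automorphisms).
Proof.
rewrite inE; apply: (iffP andP) => [[/injectiveP fI /forallP fA]|[fI fA]].
  by split=> // x y; apply/eqP; have /forallP := fA x.
split; first exact/injectiveP.
by apply/forallP => x; apply/forallP => y; rewrite fA.
Qed.

Lemma automorphisms_gt0 : 0 < #|automorphisms|.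
Proof.
apply/card_gt0P; exists [ffun x => x]; apply/automorphismsP.
by split=> [x y|x y]; rewrite !ffunE.
Qed.

Definition copy_of f : {set G} * {set {set G}} :=
  ([set f x | x : H],
   [set [set f e.1; f e.2] | e in [set e : H * H | adj e.1 e.2]]).

Lemma copy_of_edge f x y : f \in embeddings ->
  ([set f x; f y] \in (copy_of f).2) = adj x y.
Proof.
move=> /embeddingsP[fI _]; apply/imsetP/idP => [[[x' y']]|xy]; last first.
  by exists (x, y); rewrite ?inE.
rewrite inE /= => xy'; have yx' : adj y' x' by rewrite adj_sym.
move=> eq_e.
have : f x' \in [set f x; f y] by rewrite eq_e set21.
have : f y' \in [set f x; f y] by rewrite eq_e set22.
have neq_xy : x' != y' by apply: contraTneq xy' => ->; rewrite adj_irrefl.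
move=> /set2P[]/fI ey /set2P[]/fI ex; move: xy' yx' neq_xy; by rewrite ex ey ?eqxx.
Qed.

(** An isomorphism onto a subgraph followed by the inclusion is an embedding; conversely an
    embedding restricts to an isomorphism onto its image. *)
Lemma copy_ofP (c : {set G} * {set {set G}}) :
  reflect (exists2 f, f \in embeddings & c = copy_of f)
    (is_subgraph c.1 c.2 && isomorphic H (subgraph c.1 c.2)).
Proof.
case: c => W F /=; apply: (iffP andP) => [[]|[f fE [-> ->]]].
  move=> /andP[/subsetP sFE /forall_inP sFW] /existsP[g /and3P[/injectiveP gI gS gA]].
  pose f := [ffun x => val (g x)].
  have fE : f \in embeddings.
    apply/embeddingsP; split=> [x y|x y xy].
      by rewrite !ffunE => /val_inj/gI.
    have /forallP/(_ x)/forallP/(_ y)/eqP := gA.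
    by rewrite xy => /andP[_ /sFE]; rewrite set2_in_edges !ffunE.
  exists f => //; have fW z : z \in W -> exists x, z = f x.
    move=> zW; have /forallP/(_ (Sub z zW))/codomP[x eq_x] := gS.
    by exists x; rewrite ffunE -eq_x.
  congr pair.
    apply/setP => z; apply/idP/imsetP => [/fW[x ->]|[x _ ->]]; first by exists x.
    by rewrite ffunE; apply: valP.
  apply/setP => e; apply/idP/imsetP => [eF|[[x y]]].
    have /edgesP[z [w [zw e_zw]]] := sFE _ eF.
    have /subsetP sEW := sFW _ eF.
    have [x eq_z] : exists x, z = f x by apply: fW; apply: sEW; rewrite e_zw set21.
    have [y eq_w] : exists y, w = f y by apply: fW; apply: sEW; rewrite e_zw set22.
    exists (x, y); last by rewrite e_zw eq_z eq_w.
    have /forallP/(_ x)/forallP/(_ y)/eqP := gA.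
    rewrite inE /= => <-; rewrite /= /sub_adj.
    have -> : val (g x) = z by rewrite eq_z ffunE.
    have -> : val (g y) = w by rewrite eq_w ffunE.
    rewrite -e_zw eF andbT; apply: contraTneq zw => eq_g.
    by rewrite eq_z eq_w !ffunE eq_g adj_irrefl.
  rewrite inE /= => xy ->.
  have /forallP/(_ x)/forallP/(_ y)/eqP := gA.
  by rewrite xy => /andP[_]; rewrite !ffunE.
have /embeddingsP[fI fA] := fE; split.
  apply/andP; split.
    apply/subsetP => e /imsetP[[x y]]; rewrite inE /= => xy ->.
    by rewrite set2_in_edges fA.
  apply/forall_inP => e /imsetP[[x y]]; rewrite inE /= => xy ->.
  by apply/subsetP => z /set2P[]->; apply: imset_f.
have fW x : f x \in [set f x | x : H] by apply: imset_f.
apply/existsP.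
exists [ffun x => (Sub (f x) (fW x) : subgraph (copy_of f).1 (copy_of f).2)].
apply/and3P; split.
- by apply/injectiveP => x y; rewrite !ffunE => /(congr1 val)/fI.
- apply/forallP => -[z zW]; apply/codomP; have /imsetP[x _ eq_z] := zW.
  by exists x; rewrite ffunE; apply: val_inj.
- apply/forallP => x; apply/forallP => y; rewrite !ffunE /= /sub_adj /=.
  rewrite -[X in _ && X]/([set f x; f y] \in (copy_of f).2) copy_of_edge //.
  rewrite andb_idl // => xy; apply: contraTneq xy => /(congr1 val)/fI ->.
  by rewrite adj_irrefl.
Qed.

(** Embeddings with the same image as [f0] are exactly the composites of [f0] with an automorphism,
    which is unique because [f0] is injective. *)
Lemma card_copy_fiber f0 : f0 \in embeddings ->
  #|[set f in embeddings | copy_of f == copy_of f0]| = #|automorphisms|.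
Proof.
move=> f0E; have /embeddingsP[f0I f0A] := f0E.
have -> : [set f in embeddings | copy_of f == copy_of f0] =
    (fun s : {ffun H -> H} => [ffun x => f0 (s x)]) @: automorphisms.
  apply/setP => f; rewrite [LHS]inE; apply/andP/imsetP.
    move=> [fE /eqP eq_c]; have /embeddingsP[fI fA] := fE.
    have im x : exists y, f x == f0 y.
      have : f x \in (copy_of f0).1 by rewrite -eq_c imset_f.
      by case/imsetP => y _ ->; exists y.
    pose s := [ffun x => xchoose (im x)].
    have sE x : f0 (s x) = f x by rewrite ffunE; apply/esym/eqP/(xchooseP (im x)).
    exists s; last by apply/ffunP => x; rewrite ffunE sE.
    apply/automorphismsP; split=> [x y eq_s|x y].
      by apply: fI; rewrite -!sE eq_s.
    by rewrite -(copy_of_edge _ _ f0E) -eq_c !sE copy_of_edge.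
  move=> [s /automorphismsP[sI sA] ->].
  have [s' sK s'K] : bijective s := injF_bij sI.
  split.
    apply/embeddingsP; split=> [x y|x y xy].
      by rewrite !ffunE => /f0I/sI.
    by rewrite !ffunE f0A ?sA.
  apply/eqP; congr pair.
    apply/setP => z; apply/imsetP/imsetP => -[x _ ->]; rewrite ?ffunE.
      by exists (s x).
    by exists (s' x); rewrite ?ffunE ?s'K.
  apply/setP => e; apply/imsetP/imsetP => -[[x y]]; rewrite inE /= => xy ->.
    by exists (s x, s y); rewrite ?inE /= ?sA ?ffunE.
  by exists (s' x, s' y); rewrite ?inE /= ?ffunE ?s'K // -sA !s'K.
rewrite card_imset // => s t /ffunP eq_st; apply/ffunP => x.
by apply: f0I; have := eq_st x; rewrite !ffunE.
Qed.

Lemma card_embeddings : #|embeddings| = nb_copies H G * #|automorphisms|.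
Proof.
rewrite /nb_copies -sum1_card (partition_big copy_of
  (mem [set c | is_subgraph c.1 c.2 && isomorphic H (subgraph c.1 c.2)])); last first.
  by move=> f fE; rewrite /= inE; apply/copy_ofP; exists f.
rewrite -sum_nat_const; apply: eq_bigr => c; rewrite /= inE => /copy_ofP[f0 f0E ->].
rewrite -(card_copy_fiber f0E) -sum1_card.
by apply: eq_bigl => f; rewrite [RHS]inE.
Qed.

End Copies.

(** * Counting embeddings by vertex deletion *)

Section Counting.
Variables H G : sgraph.
(* Non-adjacency is transitive, that is, H is complete multipartite. *)
Hypothesis H_multi : forall h x y : H, adj x y -> adj h x || adj h y.
Implicit Types (f : {ffun H -> G}) (A S L : {set G}).

Definition nbhd (h : H) : {set H} := [set x | adj h x].

(** When [H] is complete multipartite this is the size of the part of [h] without [h] itself, which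
    the predecessor removes. *)
Definition others (h : H) : nat := (#|H| - #|nbhd h|).-1.

Lemma nbhd_others (h : H) : (#|nbhd h| + others h).+1 = #|H|.
Proof.
have : #|h |: nbhd h| <= #|H| by exact: max_card.
by rewrite cardsU1 inE adj_irrefl /others; lia.
Qed.

Local Notation weight := (emb_weight (fun h => #|nbhd h|) others).

Definition embeddings_in A : {set {ffun H -> G}} :=
  [set f in embeddings H G | [forall x, f x \in A]].

Lemma embeddings_inP A f :
  reflect (f \in embeddings H G /\ forall x, f x \in A) (f \in embeddings_in A).
Proof.
by rewrite [_ \in embeddings_in _]inE; apply: (iffP andP) => -[fE /forallP].
Qed.

(** By injectivity an embedding that does not avoid [v] takes it at exactly one vertex [h]. *)
Lemma card_embeddings_inU1 v S : v \notin S ->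
  #|embeddings_in (v |: S)| = #|embeddings_in S|
    + \sum_(h : H) #|[set f in embeddings_in (v |: S) | f h == v]|.
Proof.
move=> vS.
have sub f : f \in embeddings_in S -> f \in embeddings_in (v |: S).
  by move=> /embeddings_inP[fE fS]; apply/embeddings_inP; split=> // x; rewrite inE fS orbT.
have -> : #|embeddings_in S|
    = \sum_(f in embeddings_in (v |: S)) (f \in embeddings_in S).
  rewrite -sum1_card big_mkcond [RHS]big_mkcond; apply: eq_bigr => f _.
  by case: (boolP (f \in embeddings_in S)) => [/sub->|_]; last case: ifP.
have -> : \sum_(h : H) #|[set f in embeddings_in (v |: S) | f h == v]|
    = \sum_(f in embeddings_in (v |: S)) \sum_(h : H) (f h == v).
  rewrite exchange_big; apply: eq_bigr => h _.
  by rewrite -sum1dep_card big_mkcondr; apply: eq_bigr => f _; case: eqP.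
rewrite -big_split -sum1_card; apply: eq_bigr => f fE /=.
have /embeddings_inP[fEm fvS] := fE; have /embeddingsP[fI _] := fEm.
have [/existsP[h /eqP fh]|/existsPn nov] := boolP [exists h, f h == v].
  rewrite (bigD1 h) //= fh eqxx big1 => [|g neq_gh]; last first.
    by rewrite -fh (inj_eq fI) (negPf neq_gh).
  suff /negPf-> : f \notin embeddings_in S by [].
  by apply: contra vS => /embeddings_inP[_ /(_ h)]; rewrite fh.
rewrite big1 => [|h _]; last by rewrite (negPf (nov h)).
suff -> : f \in embeddings_in S by rewrite addn0.
apply/embeddings_inP; split=> // x.
by have := fvS x; rewrite !inE (negPf (nov x)).
Qed.

(** An embedding with [f h = v] sends the neighbours of [h] to neighbours of [v] in [S], of which
    there are at most [t], and the other vertices anywhere in [S]. *)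
Lemma embeddings_in_le v t S : v \notin S -> degree v <= t ->
  #|embeddings_in (v |: S)| <= #|embeddings_in S| + weight t #|S|.
Proof.
move=> vS le_vt; rewrite card_embeddings_inU1 // leq_add2l; apply: leq_sum => h _.
pose D := [set y in S | adj v y].
have le_Dt : #|D| <= t.
  apply: leq_trans le_vt; apply: subset_leq_card.
  by apply/subsetP => y; rewrite !inE => /andP[].
apply: (@leq_trans (#|D| ^_ #|nbhd h| * (#|S| - #|nbhd h|) ^_ others h)); last first.
  by rewrite leq_mul2r leq_ffact2l ?orbT.
rewrite /others -(@card_pinned_inj _ _ v v D S h) //; first last.
- by apply/subsetP => y; rewrite inE => /andP[].
- by rewrite inE (negPf vS).
- by rewrite inE adj_irrefl.
apply: subset_leq_card; apply/subsetP => f; rewrite inE => /andP[].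
move=> /embeddings_inP[/embeddingsP[fI fA] fS] /eqP fh; apply/pinjT; split=> // x.
case: eqVneq => [->|neq_xh]; first by rewrite fh set11.
have neq_fx : f x != v by rewrite -fh (inj_eq fI).
have := fS x; case: ifPn; rewrite !inE (negPf neq_fx) //= => /fA.
by rewrite fh => -> ->.
Qed.

(** Every injection sending [h] to [v], the neighbours of [h] into [K] and the rest into [S] is an
    embedding: each edge of [H] has an end adjacent to [h], whose image lies in [K] and is adjacent
    to all other vertices. *)
Lemma embeddings_in_ge v (K S : {set G}) : v \notin S -> K \subset S ->
  (forall x y, x \in K -> y != x -> adj x y) ->
  #|embeddings_in S| + weight #|K| #|S| <= #|embeddings_in (v |: S)|.
Proof.
move=> vS sKS K_dom; rewrite card_embeddings_inU1 // leq_add2l; apply: leq_sum => h _.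
have vK : v \notin K by apply: contra vS; apply: (subsetP sKS).
rewrite /others -(@card_pinned_inj _ _ v v K S h (nbhd h)) //; last first.
  by rewrite inE adj_irrefl.
apply: subset_leq_card; apply/subsetP => f /pinjT[fB fI].
have fh : f h = v by apply/set1P; have := fB h; rewrite eqxx.
have fK x : adj h x -> f x \in K.
  move=> hx; have := fB x; rewrite inE hx.
  case: eqVneq => [eq_x|neq_x]; first by rewrite eq_x adj_irrefl in hx.
  by rewrite !inE -fh (inj_eq fI) (negPf neq_x).
rewrite inE fh eqxx andbT; apply/embeddings_inP; split=> [|x]; last first.
  have := fB x; case: eqP => [_|_]; first by rewrite !inE => ->.
  by case: ifP; rewrite !inE // => _ /orP[->//|/(subsetP sKS)->]; rewrite orbT.
apply/embeddingsP; split=> // x y xy.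
have neq_xy : f y != f x.
  by rewrite (inj_eq fI); apply: contraTneq xy => ->; rewrite adj_irrefl.
case/orP: (H_multi h xy) => [hx|hy]; first exact: K_dom (fK _ hx) neq_xy.
by rewrite adj_sym; apply: K_dom (fK _ hy) _; rewrite eq_sym.
Qed.

Lemma embeddings_in_leU t A L : [disjoint A & L] ->
  {in L, forall v, degree v <= t} ->
  #|embeddings_in (A :|: L)| <= #|embeddings_in A|
    + \sum_(#|A| <= m < #|A| + #|L|) weight t m.
Proof.
have [m le_Lm] := ubnP #|L|; elim: m => // m IHm in L le_Lm *.
have [->|[v vL]] := set_0Vmem L; first by rewrite setU0 leq_addr.
have cL := cardsD1 v L; rewrite vL add1n in cL.
move=> dAL degL.
have dAL' : [disjoint A & L :\ v] by rewrite (disjointWr _ dAL) ?subD1set.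
have vAL : v \notin A :|: L :\ v by rewrite !inE eqxx (disjointFl dAL vL).
rewrite -(setD1K vL) setUCA; apply: leq_trans (embeddings_in_le vAL (degL _ vL)) _.
have -> : #|A :|: L :\ v| = #|A| + #|L :\ v|.
  by apply/eqP; rewrite (leq_card_setU A (L :\ v)).
rewrite setD1K // cL addnS big_nat_recr ?leq_addr //= addnA leq_add2r.
by apply: IHm => [|//|w /setD1P[_ /degL//]]; rewrite -ltnS -cL.
Qed.

Lemma embeddings_in_geU (K A L : {set G}) : [disjoint A & L] -> K \subset A ->
  (forall x y, x \in K -> y != x -> adj x y) ->
  #|embeddings_in A| + \sum_(#|A| <= m < #|A| + #|L|) weight #|K| m
    <= #|embeddings_in (A :|: L)|.
Proof.
have [m le_Lm] := ubnP #|L|; elim: m => // m IHm in L le_Lm *.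
have [->|[v vL]] := set_0Vmem L.
  by rewrite setU0 cards0 addn0 big_geq // addn0.
have cL := cardsD1 v L; rewrite vL add1n in cL.
move=> dAL sKA K_dom.
have dAL' : [disjoint A & L :\ v] by rewrite (disjointWr _ dAL) ?subD1set.
have vAL : v \notin A :|: L :\ v by rewrite !inE eqxx (disjointFl dAL vL).
have sKAL : K \subset A :|: L :\ v by rewrite subsetU ?sKA.
rewrite -(setD1K vL) setUCA; apply: leq_trans _ (embeddings_in_ge vAL sKAL K_dom).
have -> : #|A :|: L :\ v| = #|A| + #|L :\ v|.
  by apply/eqP; rewrite (leq_card_setU A (L :\ v)).
rewrite setD1K // cL addnS big_nat_recr ?leq_addr //= addnA leq_add2r.
by apply: IHm => //; rewrite -ltnS -cL.
Qed.

Lemma card_embeddings_in_le (d : G) A : #|embeddings_in A| <= #|A| ^_ #|H|.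
Proof.
rewrite -(card_inj_into H d); apply: subset_leq_card; apply/subsetP => f.
by move=> /embeddings_inP[/embeddingsP[fI _] fA]; apply/pinjT.
Qed.

Lemma card_embeddings_in_clique (d : G) A :
  {in A &, forall x y, x != y -> adj x y} -> #|A| ^_ #|H| <= #|embeddings_in A|.
Proof.
move=> cliqueA.
rewrite -(card_inj_into H d); apply: subset_leq_card; apply/subsetP => f.
move=> /pinjT[fA fI]; apply/embeddings_inP; split=> //; apply/embeddingsP.
split=> // x y xy; apply: cliqueA => //; rewrite (inj_eq fI).
by apply: contraTneq xy => ->; rewrite adj_irrefl.
Qed.

Lemma embeddings_inT : embeddings_in setT = embeddings H G.
Proof.
by apply/setP => f; rewrite inE andb_idr // => _; apply/forallP => x; rewrite inE.
Qed.

End Counting.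

(** * Upper bound from the matching number and the minimum degree *)

Lemma min_degree_le (G : sgraph) (x : G) : min_degree G <= degree x.
Proof.
rewrite /min_degree; have := mem_index_enum x.
elim: (index_enum G) => //= y s IHs; rewrite inE big_cons geq_min.
by case/orP => [/eqP<-|/IHs->]; rewrite ?leqnn ?orbT.
Qed.

Lemma exists_subset_card (T : finType) (A : {set T}) (m : nat) :
  m <= #|A| -> exists2 B : {set T}, B \subset A & #|B| = m.
Proof.
case/card_geqP => s [s_uniq <- sA]; exists [set x in s].
  by apply/subsetP => x; rewrite inE => /sA.
by rewrite cardsE; apply/card_uniqP.
Qed.

Section UpperBound.
Variable H : sgraph.

Local Notation bound := (emb_bound (fun h : H => #|nbhd h|) (@others H)).

(* A non-adjacent pair of largest degree sum forces every vertex not adjacent to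
   its larger-degree end [v] to have degree at most that of the other end [u]. *)
Lemma embeddings_le_closed (G : sgraph) (a k : nat) (u0 v0 : G) :
  2 * a < #|G| -> (forall x : G, k <= degree x) ->
  u0 != v0 -> ~~ adj u0 v0 ->
  (forall u v : G, u != v -> ~~ adj u v -> degree u + degree v <= 2 * a) ->
  exists2 t, k <= t <= a & #|embeddings H G| <= bound #|G| (2 * a) t.
Proof.
move=> lt_aG le_k neq_uv0 uv0 closed.
pose P (e : G * G) := (e.1 != e.2) && ~~ adj e.1 e.2.
have P0 : P (u0, v0) by rewrite /P neq_uv0.
have [u [v [neq_uv uv le_uv uv_max]]] : exists u v : G, [/\ u != v, ~~ adj u v,
    degree u <= degree v & forall x y : G, x != y -> ~~ adj x y ->
      degree x + degree y <= degree u + degree v].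
  case: (arg_maxnP (fun e : G * G => degree e.1 + degree e.2) P0).
  move=> [u v] /andP[/= neq_uv uv] uv_max.
  have {}uv_max (x y : G) : x != y -> ~~ adj x y ->
      degree x + degree y <= degree u + degree v.
    by move=> neq_xy xy; apply: (uv_max (x, y)); rewrite /P /= neq_xy.
  have [le_uv|/ltnW le_vu] := leqP (degree u) (degree v); first by exists u, v.
  by exists v, u; split; rewrite // 1?eq_sym 1?adj_sym // addnC.
have deg_uv := closed u v neq_uv uv.
(* Here [2 * degree u <= degree u + degree v <= 2 * a]. *)
exists (degree u); first by rewrite le_k; lia.
set t := degree u in deg_uv uv_max *.
pose L := [set w | (w != v) && ~~ adj v w].
have degL w : w \in L -> degree w <= t.
  rewrite inE => /andP[neq_wv vw].
  by have := uv_max w v neq_wv; rewrite adj_sym vw leq_add2r => ->.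
have cardL : #|L| + (degree v).+1 = #|G|.
  have -> : L = ~: (v |: [set w | adj v w]).
    by apply/setP => w; rewrite !inE negb_or.
  rewrite -(cardsC (v |: [set w | adj v w])) addnC cardsU1 inE adj_irrefl.
  by rewrite add1n.
(* The size chosen for [L0] is that of the edgeless part of [G(n, 2a, t)]; [L] is large enough
   because [degree v <= 2 * a - t]. *)
have [|L0 sL0 cL0] := @exists_subset_card _ L (#|G| - ((2 * a).+1 - t)); first by lia.
have cA : #|~: L0| = (2 * a).+1 - t by have := cardsC L0; lia.
rewrite -embeddings_inT -(setUCr L0) setUC.
apply: leq_trans (embeddings_in_leU (t := t) _ _ _) _.
- by rewrite disjoint_sym disjoints_subset setCK.
- by move=> w /(subsetP sL0)/degL.
rewrite /emb_bound cA cL0 subnKC; last by lia.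
(* The [2a + 1 - t] vertices that remain embed at most as many copies as a clique. *)
by rewrite leq_add2r -cA; apply: card_embeddings_in_le u _.
Qed.

(** Induction on the number of non-adjacent ordered pairs: an edge allowed by
    [matching_number_closure] keeps all hypotheses and loses no embedding. *)
Lemma embeddings_le_bound (G : sgraph) (a k : nat) :
  2 * a + 2 <= #|G| -> (forall x : G, k <= degree x) -> matching_number G <= a ->
  exists2 t, k <= t <= a & #|embeddings H G| <= bound #|G| (2 * a) t.
Proof.
have [m] := ubnP #|[set e : G * G | ~~ adj e.1 e.2]|.
elim: m G => // m IHm G le_m le_aG le_k mnG.
have [/existsP[u /existsP[v /and3P[neq_uv uv deg_uv]]]|/existsPn closed] :=
  boolP [exists u : G, exists v : G,
          [&& u != v, ~~ adj u v & 2 * a < degree u + degree v]].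
  have sub x y : @adj G x y -> @adj (add_edge u v) x y.
    by move=> xy; rewrite /= /add_edge_adj xy.
  have [||||t le_t leE] := IHm (add_edge u v); rewrite //.
  - rewrite -ltnS; apply: leq_trans le_m; rewrite ltnS; apply: proper_card; apply/properP.
    split; first by apply/subsetP => -[x y]; rewrite !inE; apply: contra (sub x y).
    exists (u, v); rewrite inE //= /add_edge_adj negbK.
    by rewrite neq_uv eqxx orbT.
  - move=> x; apply: leq_trans (le_k x) _; apply: subset_leq_card.
    by apply/subsetP => y; rewrite !inE; apply: sub.
  - exact: matching_number_closure.
  exists t => //; apply: leq_trans leE; apply: subset_leq_card.
  apply/subsetP => f /embeddingsP[fI fA].
  by apply/(@embeddingsP H (add_edge u v)); split=> // x y /fA/sub.
(* A maximum matching covers at most [2 * a] vertices, so it misses two, and these are non-adjacent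
   since otherwise the matching could grow. They start the argument for closed graphs. *)
have [M mM cM] := maximum_matching G.
have : 1 < #|~: cover M|.
  by have := cardsC (cover M); rewrite card_cover_matching // cM; lia.
move=> /card_geqP[[|u [|v [|? ?]]]] [] // /andP[neq_uv _] _ uvM.
have uM : u \notin cover M by rewrite -in_setC uvM ?inE ?eqxx.
have vM : v \notin cover M by rewrite -in_setC uvM ?inE ?eqxx ?orbT.
apply: (@embeddings_le_closed _ _ _ u v) => //.
- by lia.
- by move: neq_uv; rewrite inE.
- apply/negP => uv; have [mN cN] := matchingU1 mM uv uM vM.
  by have := leq_matching_number mN; rewrite cN cM ltnn.
move=> x y neq_xy xy; have /existsPn/(_ y) := closed x.
by rewrite neq_xy xy /= -leqNgt.
Qed.

End UpperBound.

(** * Embeddings into the extremal graph *)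

Section LowerBound.
Variable H : sgraph.
Hypothesis H_multi : forall h x y : H, adj x y -> adj h x || adj h y.

Local Notation bound := (emb_bound (fun h : H => #|nbhd h|) (@others H)).

Lemma bound_le_extremal (n a t : nat) : t <= a -> 2 * a + 2 <= n ->
  bound n (2 * a) t <= #|embeddings H (extremal_graph n (2 * a) t)|.
Proof.
move=> le_ta le_an; set E := extremal_graph n (2 * a) t.
(* [K] is the dominating part [K_t], and [A] adds the other complete part, giving a clique on
   [2a + 1 - t] vertices whose complement is the edgeless part. *)
pose K : {set E} := [set x | if x is inl _ then true else false].
pose A : {set E} := [set x | if x is inr (inr _) then false else true].
have cE : #|E| = n by rewrite card_sum card_ord card_sum !card_ord; lia.
have cK : #|K| = t.
  have -> : K = [set inl i | i : 'I_t].
    apply/setP => -[i|i]; rewrite inE.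
      by rewrite imset_f.
    by apply/esym/negbTE/imsetP => -[].
  by rewrite card_imset ?card_ord // => i j [].
have cAC : #|~: A| = n - 2 * a - 1 + t.
  have -> : ~: A = [set inr (inr i) | i : 'I_(n - 2 * a - 1 + t)].
    apply/setP => -[i|[i|i]]; rewrite !inE /=; last by rewrite imset_f.
      by apply/esym/negbTE/imsetP => -[].
    by apply/esym/negbTE/imsetP => -[].
  by rewrite card_imset ?card_ord // => i j [].
have cA : #|A| = (2 * a).+1 - t by have := cardsC A; rewrite cAC cE; lia.
have dis : [disjoint A & ~: A] by rewrite disjoints_subset setCK.
have sKA : K \subset A by apply/subsetP => -[i|[i|i]]; rewrite !inE.
have K_dom (x y : E) : x \in K -> y != x -> adj x y.
  by case: x => [i|i]; rewrite inE //; case: y => [j|j] //= neq; rewrite eq_sym.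
have d : E by have /card_gt0P/sigW[] : 0 < #|E| by rewrite cE; lia.
have := embeddings_in_geU H_multi dis sKA K_dom.
rewrite setUCr embeddings_inT cK cAC cA; apply: leq_trans.
rewrite /emb_bound (_ : _ - t + _ = n); last by lia.
rewrite leq_add2r -cA; apply: (card_embeddings_in_clique _ d).
move=> [i|[i|i]] [j|[j|j]]; rewrite !inE //= => _ _; by apply: contraNneq => ->.
Qed.

End LowerBound.

(** * From embeddings back to copies *)

Lemma multipartite_nbr (s : nat) (r : 'I_s -> nat)
  (h x y : complete_multipartite r) : adj x y -> adj h x || adj h y.
Proof.
rewrite /= /multipartite_adj -negb_and; apply: contra.
by move=> /andP[/eqP<- /eqP<-].
Qed.

Theorem theorem3 (s : nat) (hs : 0 < s) (r : 'I_s -> nat)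
  (hr : forall i : 'I_s, 0 < r i)
  (G : sgraph) (n a k : nat)
  (hn : #|G| = n) (hna : 2 * a + 2 <= n)
  (ha : matching_number G = a) (hk : k <= min_degree G) :
  nb_copies (complete_multipartite r) G
    <= maxn (g_multipartite r n (2 * a) k) (g_multipartite r n (2 * a) a).
Proof.
set H := complete_multipartite r.
have H_multi := @multipartite_nbr s r.
pose b := emb_bound (fun h : H => #|nbhd h|) (@others H) n (2 * a).
have [||| t le_t le_b] := @embeddings_le_bound H G a k; rewrite ?hn ?ha //.
  by move=> x; apply: leq_trans hk (min_degree_le x).
have le_ka : k <= a by case/andP: le_t; apply: leq_trans.
have le_g t' : t' <= a -> b t' <= g_multipartite r n (2 * a) t' * #|automorphisms H|.
  by move=> le_ta; rewrite -card_embeddings; apply: bound_le_extremal.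
(* Multiplying by the positive number of automorphisms turns copies into embeddings, and convexity
   moves [t] to one of the ends [k] and [a]. *)
rewrite -(leq_pmul2r (automorphisms_gt0 H)) -card_embeddings maxnMl.
rewrite hn in le_b; apply: leq_trans le_b _.
apply: leq_trans (emb_bound_convex (@nbhd_others H) _ le_t) _; first by lia.
by rewrite geq_max !leq_max !le_g ?orbT.
Qed.
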